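(* Let $\Bbbk$ be a field with $\mathrm{char}(\Bbbk)\ne2$ and let $A=Cl(\alpha,\beta_i,\gamma_i,\lambda_{ij})$ be a $2^{n+1}$-dimensional Clifford algebra endowed with its canonical $E(n)$-comodule algebra structure. If $n$ is odd and $A$ is not semisimple, then the cowreath $(A\otimes E(n)^{\mathrm{op}},E(n),\psi)$ is separable and h-separable, but not Frobenius.
   Context: Everything is over a field $\Bbbk$ with $\mathrm{char}(\Bbbk)\ne2$; $\otimes=\otimes_\Bbbk$; Sweedler notation with suppressed summation is used. $E(n)$ is the $2^{n+1}$-dimensional Hopf algebra generated by $g,x_1,\dots,x_n$ with $g^2=1$, $x_i^2=0$, $gx_i=-x_ig$, $x_ix_j=-x_jx_i$ ($i<j$), $\Delta(g)=g\otimes g$, $\varepsilon(g)=1$, $S(g)=g$, $\Delta(x_i)=x_i\otimes g+1\otimes x_i$, $\varepsilon(x_i)=0$, $S(x_i)=gx_i$. $Cl(\alpha,\beta_i,\gamma_i,\lambda_{ij})$, for fixed scalars $\alpha,\beta_i,\gamma_i$ ($1\le i\le n$), $\lambda_{ij}$ ($i<j$) in $\Bbbk$, is the unital associative algebra generated by $G,X_1,\dots,X_n$ with $G^2=\alpha$, $X_i^2=\beta_i$, $GX_i+X_iG=\gamma_i$, $X_iX_j+X_jX_i=\lambda_{ij}$ ($i<j$); it has dimension $2^{n+1}$. Its canonical $E(n)$-comodule algebra structure is the algebra map $\rho$ with $\rho(G)=G\otimes g$, $\rho(X_i)=X_i\otimes g+1_A\otimes x_i$. For a Hopf algebra $H$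 and right $H$-comodule algebra $(A,\rho)$, $\rho(a)=a_0\otimes a_1$, the cowreath $(A\otimes H^{\mathrm{op}},H,\psi)$ has $\psi(h\otimes a\otimes l)=a_0\otimes l_1\otimes l_2ha_1$. Convention: products written without symbol in $A\otimes H$ use the ordinary multiplications of $A$ and $H$ (not the opposite one). A Casimir morphism for $(H,\psi)$ is a $\Bbbk$-linear map $B:H\otimes H\to A\otimes H^{\mathrm{op}}$, written $B(h\otimes h')=B^A(h\otimes h')\otimes B^H(h\otimes h')$, such that for all $a\in A$, $g,h,h'\in H$: $$(a_0\otimes 1_H)B(g_2ha_1\otimes g_3h'a_2)(1_A\otimes g_1)=(1_A\otimes g)B(h\otimes h')(a\otimes 1_H),$$ $$B^A(h_2\otimes h')_0\otimes B^H(h_2\otimes h')_1\otimes B^H(h_2\otimes h')_2h_1B^A(h_2\otimes h')_1=B(h\otimes h'_1)\otimes h'_2.$$ The cowreath is separable if there is a Casimir morphism $B$ which is normalized, i.e. $B(h_1\otimes h_2)=\varepsilon(h)1_A\otimes1_H$ for all $h$; it is h-separable if there is a normalized Casimir morphism $B$ with, for all $h,h',h''\in H$, $$B^A(h\otimes h'_1)B^A(h'_2\otimes h'')\otimes B^H(h'_2\otimes h'')B^H(h\otimes h'_1)=\varepsilon(h')B(h\otimes h'').$$ The cowreath is Frobenius if there are a Casimir morphism $B$ and an element $\mathfrak{t}=\mathfrak{t}^1\otimes\mathfrak{t}^2\otimes\mathfrak{t}^3\in A\otimes H\otimes H$ such that for all $a\in A$, $h\in H$: $$a\mathfrak{t}^1\otimes\mathfrak{t}^2h\otimes\mathfrak{t}^3=\mathfrak{t}^1a_0\otimes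 h_1\mathfrak{t}^2\otimes h_2\mathfrak{t}^3a_1,$$ $$(\mathfrak{t}^1\otimes 1_H)B(\mathfrak{t}^3\otimes h)(1_A\otimes\mathfrak{t}^2)=\varepsilon(h)1_A\otimes 1_H=(\mathfrak{t}^1_0\otimes 1_H)B(\mathfrak{t}^2_2h\mathfrak{t}^1_1\otimes\mathfrak{t}^3)(1_A\otimes\mathfrak{t}^2_1).$$ *)

(* Defs.v *)
From HB Require Import structures.
From mathcomp Require Import all_boot all_order all_algebra all_field.

Set Implicit Arguments.
Unset Strict Implicit.
Unset Printing Implicit Defensive.

Import GRing.Theory VectorInternalTheory.
Local Open Scope ring_scope.

Reserved Notation "u ⊗ v" (at level 45, left associativity).
Reserved Notation "\sw_ ( a , b <- t ) F"
  (at level 47, a name, b name, t at level 46, F at level 47,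
   format "\sw_ ( a , b  <-  t )  F").

(* The tensor product of finite-dimensional spaces U and V: the matrix t stands
   for \sum_(i, j) t i j e_i ⊗ f_j, where (e_i) and (f_j) are the bases
   underlying the vectType structures of U and V. *)
Definition tens (K : fieldType) (U V : vectType K) : Type :=
  'M[K]_(dim U, dim V).

HB.instance Definition _ (K : fieldType) (U V : vectType K) :=
  Vector.copy (tens U V) 'M[K]_(dim U, dim V).

Definition tpure (K : fieldType) (U V : vectType K) (u : U) (v : V) :
  tens U V := (v2r u)^T *m v2r v.

Notation "u ⊗ v" := (tpure u v) : ring_scope.

Definition tbasis (K : fieldType) (U : vectType K) (i : 'I_(dim U)) : U :=
  r2v (delta_mx 0 i).

(* Sweedler's summation: if t = \sum_k a_k ⊗ b_k and F is bilinear, then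
   \sw_(a, b <- t) F a b is \sum_k F a_k b_k (lemma tlift_tpure). *)
Definition tlift (K : fieldType) (U V : vectType K) (W : lmodType K)
    (F : U -> V -> W) (t : tens U V) : W :=
  \sum_i \sum_j (t : 'M_(_, _)) i j *: F (tbasis i) (tbasis j).

Notation "\sw_ ( a , b <- t ) F" := (tlift (fun a b => F) t) : ring_scope.

Section TensorTheory.

Variable K : fieldType.
Implicit Types U V : vectType K.

Lemma vect_tbasis U (u : U) : u = \sum_i v2r u 0 i *: tbasis i.
Proof.
rewrite -[LHS]v2rK {1}(row_sum_delta (v2r u)) linear_sum.
by apply: eq_bigr => i _; rewrite linearZ.
Qed.

Lemma v2r_tbasis U (i : 'I_(dim U)) : v2r (tbasis i) = delta_mx 0 i.
Proof. exact: r2vK. Qed.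

Lemma tpure_linearl U V (v : V) : linear (fun u : U => u ⊗ v).
Proof.
by move=> a u u'; rewrite /tpure linearP /= linearP /= mulmxDl scalemxAl.
Qed.

Lemma tpure_linearr U V (u : U) : linear (fun v : V => u ⊗ v).
Proof. by move=> a v v'; rewrite /tpure linearP /= mulmxDr scalemxAr. Qed.

Lemma tpureE U V (u : U) (v : V) i j :
  (u ⊗ v : 'M_(_, _)) i j = v2r u 0 i * v2r v 0 j.
Proof. by rewrite !mxE big_ord1 !mxE. Qed.

Lemma tensE U V (t : tens U V) :
  t = \sum_i \sum_j (t : 'M_(_, _)) i j *: (tbasis i ⊗ tbasis j).
Proof.
rewrite [LHS](matrix_sum_delta (t : 'M_(_, _))).
apply: eq_bigr => i _; apply: eq_bigr => j _; congr (_ *: _).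
by rewrite /tpure !v2r_tbasis trmx_delta mul_delta_mx.
Qed.

Lemma tlift_linear U V (W : lmodType K) (F : U -> V -> W) : linear (tlift F).
Proof.
move=> a t t'; rewrite /tlift scaler_sumr -big_split /=.
apply: eq_bigr => i _; rewrite scaler_sumr -big_split /=.
by apply: eq_bigr => j _; rewrite !mxE scalerDl scalerA.
Qed.

HB.instance Definition _ U V (W : lmodType K) (F : U -> V -> W) :=
  GRing.isLinear.Build K (tens U V) W *:%R (tlift F) (tlift_linear F).

Lemma tlift_tpure U V (W : lmodType K) (F : U -> V -> W) u v :
  (forall v, linear (F^~ v)) -> (forall u, linear (F u)) ->
  tlift F (u ⊗ v) = F u v.
Proof.
move=> Fl Fr.
pose fl v' := GRing.isLinear.Build K U W *:%R (F^~ v') (Fl v').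
pose Lv' v' : {linear U -> W} := HB.pack (F^~ v') (fl v').
pose fr u' := GRing.isLinear.Build K V W *:%R (F u') (Fr u').
pose Lu' u' : {linear V -> W} := HB.pack (F u') (fr u').
rewrite [in RHS](vect_tbasis u) -[RHS]/(Lv' v _) linear_sum.
apply: eq_bigr => i _; rewrite linearZ /=.
rewrite [in RHS](vect_tbasis v) -[X in _ = _ *: X]/(Lu' (tbasis i) _).
rewrite linear_sum scaler_sumr; apply: eq_bigr => j _.
by rewrite linearZ /= scalerA tpureE.
Qed.

Lemma tens_eqP U V (W : lmodType K) (f f' : {linear tens U V -> W}) :
  (forall u v, f (u ⊗ v) = f' (u ⊗ v)) -> f =1 f'.
Proof.
move=> eqf t; rewrite (tensE t) !linear_sum; apply: eq_bigr => i _.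
by rewrite !linear_sum; apply: eq_bigr => j _; rewrite !linearZ /= eqf.
Qed.

End TensorTheory.

Section TensorAlgebra.

Variables (K : fieldType) (A B : falgType K).

(* (a ⊗ b) * (c ⊗ d) = (a * c) ⊗ (b * d) *)
Definition tmul (t u : tens A B) : tens A B :=
  \sw_(a, b <- t) \sw_(c, d <- u) ((a * c) ⊗ (b * d)).

Lemma tmul_linearl u : linear (tmul^~ u).
Proof. by move=> a t t'; rewrite /tmul linearP. Qed.

Lemma tmul_linearr t : linear (tmul t).
Proof.
move=> a u u'; rewrite /tmul /tlift scaler_sumr -big_split /=.
apply: eq_bigr => i _; rewrite scaler_sumr -big_split /=.
apply: eq_bigr => j _; rewrite scalerA [a * _]mulrC -scalerA -scalerDr.
congr (_ *: _).
exact: (tlift_linear (fun c d => (tbasis i * c) ⊗ (tbasis j * d))).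
Qed.

HB.instance Definition _ t :=
  GRing.isLinear.Build K (tens A B) (tens A B) *:%R (tmul t) (tmul_linearr t).

Definition tmulr u t := tmul t u.

HB.instance Definition _ u :=
  GRing.isLinear.Build K (tens A B) (tens A B) *:%R (tmulr u) (tmul_linearl u).

Lemma tmul_pure (a c : A) (b d : B) :
  tmul (a ⊗ b) (c ⊗ d) = (a * c) ⊗ (b * d).
Proof.
have E (a' : A) (b' : B) :
    \sw_(c, d <- c ⊗ d) ((a' * c) ⊗ (b' * d)) = (a' * c) ⊗ (b' * d).
  rewrite tlift_tpure // => [v|u] k x y.
    by rewrite mulrDr -scalerAr (tpure_linearl (b' * v)).
  by rewrite mulrDr -scalerAr (tpure_linearr (a' * u)).
rewrite /tmul tlift_tpure => [|v|u]; first exact: E.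
  by move=> k x y; rewrite !E mulrDl -scalerAl (tpure_linearl (v * d)).
by move=> k x y; rewrite !E mulrDl -scalerAl (tpure_linearr (u * c)).
Qed.

Lemma tmulA : associative tmul.
Proof.
move=> t u v; move: t.
apply: (tens_eqP (f := tmulr (tmul u v)) (f' := tmulr v \o tmulr u)) => a b.
rewrite /= /tmulr; move: u.
apply: (tens_eqP (f := tmul (a ⊗ b) \o tmulr v)
                 (f' := tmulr v \o tmul (a ⊗ b))) => c d.
rewrite /= /tmulr; move: v.
apply: (tens_eqP (f := tmul (a ⊗ b) \o tmul (c ⊗ d))
                 (f' := tmul (tmul (a ⊗ b) (c ⊗ d)))) => e f.
by rewrite /= !tmul_pure !mulrA.
Qed.

Lemma tmul1 : left_id (1 ⊗ 1) tmul.
Proof.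
apply: (tens_eqP (f := tmul (1 ⊗ 1)) (f' := idfun)) => a b.
by rewrite /= tmul_pure !mul1r.
Qed.

Lemma tmulr1 : right_id (1 ⊗ 1) tmul.
Proof.
apply: (tens_eqP (f := tmulr (1 ⊗ 1)) (f' := idfun)) => a b.
by rewrite /= /tmulr tmul_pure !mulr1.
Qed.

Lemma tmulDl : left_distributive tmul +%R.
Proof. by move=> t u v; rewrite -/(tmulr v _) linearD. Qed.

Lemma tmulDr : right_distributive tmul +%R.
Proof. by move=> t u v; rewrite linearD. Qed.

Lemma tone_neq0 : (1 : A) ⊗ (1 : B) != 0.
Proof.
have nz (C : falgType K) : exists i, v2r (1 : C) 0 i != 0.
  have : v2r (1 : C) != 0.
    by apply/eqP=> /(congr1 r2v)/eqP; rewrite v2rK linear0 oner_eq0.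
  by case/rV0Pn=> i; exists i.
have [[i Hi] [j Hj]] := (nz A, nz B).
apply/eqP=> /(congr1 (fun t : 'M_(_, _) => t i j)).
by rewrite tpureE mxE => /eqP; rewrite mulf_eq0 (negbTE Hi) (negbTE Hj).
Qed.

HB.instance Definition _ := GRing.Zmodule_isNzRing.Build (tens A B)
  tmulA tmul1 tmulr1 tmulDl tmulDr tone_neq0.

Lemma tscaleAl (k : K) (t u : tens A B) : k *: (t * u) = (k *: t) * u.
Proof. by rewrite -[RHS]/(tmulr u (k *: t)) linearZ. Qed.

HB.instance Definition _ :=
  GRing.Lmodule_isLalgebra.Build K (tens A B) tscaleAl.

Lemma tscaleAr (k : K) (t u : tens A B) : k *: (t * u) = t * (k *: u).
Proof. by rewrite -[RHS]/(tmul t (k *: u)) linearZ. Qed.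

HB.instance Definition _ :=
  GRing.Lalgebra_isAlgebra.Build K (tens A B) tscaleAr.

HB.instance Definition _ := Algebra_isFalgebra.Build K (tens A B).

Lemma tens1E : 1 = 1 ⊗ 1 :> tens A B.
Proof. by []. Qed.

Lemma tensM (a c : A) (b d : B) : (a ⊗ b) * (c ⊗ d) = (a * c) ⊗ (b * d).
Proof. exact: tmul_pure. Qed.

End TensorAlgebra.

Record hopf_algebra (K : fieldType) (H : falgType K) := HopfAlgebra {
  comul : {lrmorphism H -> tens H H};
  counit : {lrmorphism H -> K^o};
  antipode : {linear H -> H};
  comul_coassoc : forall h,
    \sw_(h1, h2 <- comul h) \sw_(h11, h12 <- comul h1) (h11 ⊗ h12 ⊗ h2)
    = \sw_(h1, h2 <- comul h) \sw_(h21, h22 <- comul h2) (h1 ⊗ h21 ⊗ h22);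
  counit_left : forall h, \sw_(h1, h2 <- comul h) (counit h1 *: h2) = h;
  counit_right : forall h, \sw_(h1, h2 <- comul h) (counit h2 *: h1) = h;
  antipode_left : forall h,
    \sw_(h1, h2 <- comul h) (antipode h1 * h2) = (counit h)%:A;
  antipode_right : forall h,
    \sw_(h1, h2 <- comul h) (h1 * antipode h2) = (counit h)%:A
}.

Record comodule_algebra (K : fieldType) (H : falgType K)
    (hH : hopf_algebra H) (A : falgType K) := ComoduleAlgebra {
  coact : {lrmorphism A -> tens A H};
  coact_coassoc : forall a,
    \sw_(a0, a1 <- coact a) \sw_(a00, a01 <- coact a0) (a00 ⊗ a01 ⊗ a1)
    = \sw_(a0, a1 <- coact a) \sw_(a11, a12 <- comul hH a1) (a0 ⊗ a11 ⊗ a12);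
  coact_counit : forall a, \sw_(a0, a1 <- coact a) (counit hH a1 *: a0) = a
}.

(* The cowreath (A ⊗ H^op, H, psi), with
     psi (h ⊗ a ⊗ l) = a_0 ⊗ l_1 ⊗ l_2 h a_1,
   is determined by the H-comodule algebra A, and the properties below are those
   of this cowreath.  As vector spaces A ⊗ H^op and A ⊗ H coincide, and every
   product written below is that of A, of H, or of the ordinary tensor product
   algebra A ⊗ H: no product of H^op is used. *)
Section Cowreath.

Variables (K : fieldType) (H : falgType K) (hH : hopf_algebra H).
Variables (A : falgType K) (cA : comodule_algebra hH A).

Let Delta : H -> tens H H := comul hH.
Let eps : H -> K := counit hH.
Let rho : A -> tens A H := coact cA.

Record casimir (B : {linear tens H H -> tens A H}) : Prop := Casimir {
  casimir_bilinear : forall (a : A) (g h h' : H),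
    \sw_(a0, a12 <- rho a) \sw_(a1, a2 <- Delta a12)
    \sw_(g1, g23 <- Delta g) \sw_(g2, g3 <- Delta g23)
      ((a0 ⊗ 1) * B ((g2 * h * a1) ⊗ (g3 * h' * a2)) * (1 ⊗ g1))
    = (1 ⊗ g) * B (h ⊗ h') * (a ⊗ 1);
  casimir_colinear : forall h h' : H,
    \sw_(h1, h2 <- Delta h) \sw_(b, l <- B (h2 ⊗ h'))
    \sw_(b0, b1 <- rho b) \sw_(l1, l2 <- Delta l)
      (b0 ⊗ l1 ⊗ (l2 * h1 * b1))
    = \sw_(h'1, h'2 <- Delta h') (B (h ⊗ h'1) ⊗ h'2)
}.

Definition normalized (B : {linear tens H H -> tens A H}) : Prop :=
  forall h : H, B (Delta h) = eps h *: (1 ⊗ 1).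

Definition cowreath_separable : Prop :=
  exists2 B : {linear tens H H -> tens A H}, casimir B & normalized B.

Definition cowreath_hseparable : Prop :=
  exists B : {linear tens H H -> tens A H},
  [/\ casimir B, normalized B &
      forall h h' h'' : H,
        \sw_(h'1, h'2 <- Delta h')
        \sw_(b, l <- B (h ⊗ h'1)) \sw_(c, m <- B (h'2 ⊗ h''))
          ((b * c) ⊗ (m * l))
        = eps h' *: B (h ⊗ h'')].

Definition cowreath_frobenius : Prop :=
  exists (B : {linear tens H H -> tens A H}) (t : tens (tens A H) H),
  [/\ casimir B,
      forall (a : A) (h : H),
        \sw_(t12, t3 <- t) \sw_(t1, t2 <- t12)
          ((a * t1) ⊗ (t2 * h) ⊗ t3)
        = \sw_(t12, t3 <- t) \sw_(t1, t2 <- t12)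
          \sw_(a0, a1 <- rho a) \sw_(h1, h2 <- Delta h)
            ((t1 * a0) ⊗ (h1 * t2) ⊗ (h2 * t3 * a1)),
      forall h : H,
        \sw_(t12, t3 <- t) \sw_(t1, t2 <- t12)
          ((t1 ⊗ 1) * B (t3 ⊗ h) * (1 ⊗ t2))
        = eps h *: (1 ⊗ 1) &
      forall h : H,
        \sw_(t12, t3 <- t) \sw_(t1, t2 <- t12)
        \sw_(u0, u1 <- rho t1) \sw_(v1, v2 <- Delta t2)
          ((u0 ⊗ 1) * B ((v2 * h * u1) ⊗ t3) * (1 ⊗ v1))
        = eps h *: (1 ⊗ 1)].

End Cowreath.

(* A is generated by a and (b_i), subject only to the relations R. *)
Record presented_by (K : fieldType) (n : nat)
    (R : forall B : algType K, B -> ('I_n -> B) -> Prop)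
    (A : algType K) (a : A) (b : 'I_n -> A) : Prop := PresentedBy {
  presented_rels : R A a b;
  presented_lift : forall (B : algType K) (c : B) (d : 'I_n -> B), R B c d ->
    exists f : {lrmorphism A -> B}, f a = c /\ forall i, f (b i) = d i;
  presented_uniq : forall (B : algType K) (f f' : {lrmorphism A -> B}),
    f a = f' a -> (forall i, f (b i) = f' (b i)) -> f =1 f'
}.

Definition clifford_rels (K : fieldType) (n : nat) (alpha : K)
    (beta gamma : 'I_n -> K) (lambda : 'I_n -> 'I_n -> K)
    (B : algType K) (G : B) (X : 'I_n -> B) : Prop :=
  [/\ G ^+ 2 = alpha%:A,
      forall i, X i ^+ 2 = (beta i)%:A,
      forall i, G * X i + X i * G = (gamma i)%:A &
      forall i j : 'I_n, (i < j)%N -> X i * X j + X j * X i = (lambda i j)%:A].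

(* The values of lambda at (i, j) with j <= i play no role. *)
Definition is_clifford (K : fieldType) (n : nat) (alpha : K)
    (beta gamma : 'I_n -> K) (lambda : 'I_n -> 'I_n -> K)
    (A : falgType K) (G : A) (X : 'I_n -> A) : Prop :=
  presented_by (@clifford_rels K n alpha beta gamma lambda) G X
  /\ \dim {:A} = (2 ^ n.+1)%N.

Definition E_rels (K : fieldType) (n : nat)
    (B : algType K) (g : B) (x : 'I_n -> B) : Prop :=
  [/\ g ^+ 2 = 1,
      forall i, x i ^+ 2 = 0,
      forall i, g * x i = - (x i * g) &
      forall i j : 'I_n, (i < j)%N -> x i * x j = - (x j * x i)].

Record is_E (K : fieldType) (n : nat) (H : falgType K) (hH : hopf_algebra H)
    (g : H) (x : 'I_n -> H) : Prop := IsE {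
  E_presented : presented_by (@E_rels K n) g x;
  E_dim : \dim {:H} = (2 ^ n.+1)%N;
  E_comul_g : comul hH g = g ⊗ g;
  E_counit_g : counit hH g = 1;
  E_antipode_g : antipode hH g = g;
  E_comul_x : forall i, comul hH (x i) = x i ⊗ g + 1 ⊗ x i;
  E_counit_x : forall i, counit hH (x i) = 0;
  E_antipode_x : forall i, antipode hH (x i) = g * x i
}.

Definition canonical_coaction (K : fieldType) (n : nat) (H : falgType K)
    (hH : hopf_algebra H) (g : H) (x : 'I_n -> H)
    (A : falgType K) (cA : comodule_algebra hH A)
    (G : A) (X : 'I_n -> A) : Prop :=
  coact cA G = G ⊗ g /\ forall i, coact cA (X i) = X i ⊗ g + 1 ⊗ x i.

(* The regular left module is semisimple: every left ideal is a direct
   summand. *)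
Definition semisimple (K : fieldType) (A : falgType K) : Prop :=
  forall U : {vspace A}, ({:A} * U <= U)%VS ->
  exists W : {vspace A},
    [/\ ({:A} * W <= W)%VS, (U + W = fullv)%VS & (U :&: W = 0)%VS].

(* Main.v *)
From HB Require Import structures.
From mathcomp Require Import all_boot all_order all_algebra all_field.
Require Import Defs.

(* Let T be the inverse of the antipode.  B(h ⊗ h') = 1 ⊗ h' T(h) is a
   normalized multiplicative Casimir morphism whatever the comodule algebra A.

   Suppose the cowreath is Frobenius.  Applying the counit to the middle factor
   of t turns the first Frobenius identity into: c = t^1 ⊗ eps(t^2) t^3
   satisfies (1 ⊗ h) c = eps(h) c and (a ⊗ 1) c = c rho(a).  The left integrals
   of E(n) are the multiples of lam = x_1 ... x_n (1 - g), and for odd n one has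
   lam g = - lam and lam x_i = 0.  Hence c = u ⊗ lam, where u anticommutes with
   G and all X_i; the second Frobenius identity makes u invertible.  This forces
   the quadratic form on the span V of the generators to be nondegenerate, and
   averaging over an orthogonal basis of V shows, as in Maschke's theorem, that
   A is semisimple. *)

Set Implicit Arguments.
Unset Strict Implicit.
Unset Printing Implicit Defensive.

Import GRing.Theory VectorInternalTheory.
Local Open Scope ring_scope.

(** * Linearity as a proposition, for maps written as Sweedler sums *)

Section Linearity.

Variable K : fieldType.

Lemma lin_id (U : lmodType K) : linear (fun u : U => u).
Proof. by []. Qed.

Lemma lin_comp (U V W : lmodType K) (L : {linear V -> W}) (f : U -> V) :
  linear f -> linear (fun u => L (f u)).
Proof. by move=> lf k u v; rewrite lf linearP. Qed.

Lemma lin_scaler (U V : lmodType K) (k : K) (f : U -> V) :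
  linear f -> linear (fun u => k *: f u).
Proof. exact: lin_comp. Qed.

Lemma lin_scalel (U V : lmodType K) (f : U -> K^o) (v : V) :
  linear f -> linear (fun u => f u *: v).
Proof. by move=> lf k u w; rewrite lf scalerDl -scalerA. Qed.

Lemma lin_mull (U : lmodType K) (B : algType K) (f : U -> B) (b : B) :
  linear f -> linear (fun u => f u * b).
Proof. by move=> lf k u w; rewrite lf mulrDl -scalerAl. Qed.

Lemma lin_mulr (U : lmodType K) (B : algType K) (f : U -> B) (b : B) :
  linear f -> linear (fun u => b * f u).
Proof. by move=> lf k u w; rewrite lf mulrDr -scalerAr. Qed.

Lemma lin_add (U V : lmodType K) (f f' : U -> V) :
  linear f -> linear f' -> linear (fun u => f u + f' u).
Proof. by move=> lf lf' k u w; rewrite lf lf' scalerDr addrACA. Qed.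

Lemma lin_tpurel (U : lmodType K) (V W : vectType K) (f : U -> V) (w : W) :
  linear f -> linear (fun u => f u ⊗ w).
Proof. by move=> lf k u v; rewrite lf (tpure_linearl w). Qed.

Lemma lin_tpurer (U : lmodType K) (V W : vectType K) (f : U -> V) (w : W) :
  linear f -> linear (fun u => w ⊗ f u).
Proof. by move=> lf k u v; rewrite lf (tpure_linearr w). Qed.

Lemma lin_tlift (U : lmodType K) (V V' : vectType K) (W : lmodType K)
    (F : V -> V' -> W) (f : U -> tens V V') :
  linear f -> linear (fun u => \sw_(a, b <- f u) F a b).
Proof. exact: lin_comp. Qed.

Lemma lin_tliftF (U : lmodType K) (V V' : vectType K) (W : lmodType K)
    (F : U -> V -> V' -> W) (t : tens V V') :
  (forall a b, linear (fun u => F u a b)) ->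
  linear (fun u => \sw_(a, b <- t) F u a b).
Proof.
move=> lF k u v; rewrite /tlift scaler_sumr -big_split /=.
apply: eq_bigr => i _; rewrite scaler_sumr -big_split /=.
by apply: eq_bigr => j _; rewrite lF scalerDr !scalerA mulrC.
Qed.

End Linearity.

(** Peels off one operation at a time; [lin_comp] comes last, as the catch-all for bundled linear
    maps. *)
Ltac lin := intros; cbv beta; repeat first
  [ assumption | exact: lin_id | apply: lin_scaler | apply: lin_mull | apply: lin_mulr
  | apply: lin_tpurel | apply: lin_tpurer | apply: lin_add | apply: lin_scalel
  | apply: lin_tlift | (apply: lin_tliftF => ? ?) | apply: lin_comp ].

(** * Calculus of Sweedler sums: congruence, exchange, products, coassociativity *)

Section Sweedler.

Variable K : fieldType.

Lemma tpureZl (U V : vectType K) k (u : U) (v : V) : (k *: u) ⊗ v = k *: (u ⊗ v).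
Proof. by rewrite /tpure !linearZ /= scalemxAl. Qed.

Lemma tpureZr (U V : vectType K) k (u : U) (v : V) : u ⊗ (k *: v) = k *: (u ⊗ v).
Proof. by rewrite /tpure linearZ /= scalemxAr. Qed.

Lemma eq_tlift (U V : vectType K) (W : lmodType K) (F F' : U -> V -> W) t :
  (forall a b, F a b = F' a b) -> \sw_(a, b <- t) F a b = \sw_(a, b <- t) F' a b.
Proof.
by move=> eqF; apply: eq_bigr => i _; apply: eq_bigr => j _; rewrite eqF.
Qed.

(** [L] is a plain function with a linearity proof, so that maps given by lambda terms need not be
    bundled. *)
Lemma linear_tlift (U V : vectType K) (W W' : lmodType K) (L : W -> W')
    (F : U -> V -> W) t :
  linear L -> L (\sw_(a, b <- t) F a b) = \sw_(a, b <- t) L (F a b).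
Proof.
move=> lL; pose L' : {linear W -> W'} :=
  HB.pack L (GRing.isLinear.Build K W W' *:%R L lL).
rewrite -[L]/(L' : _ -> _) linear_sum; apply: eq_bigr => i _.
by rewrite linear_sum; apply: eq_bigr => j _; rewrite linearZ.
Qed.

Lemma tens_linear_eq (U V : vectType K) (W : lmodType K) (f f' : tens U V -> W) :
  linear f -> linear f' -> (forall u v, f (u ⊗ v) = f' (u ⊗ v)) -> f =1 f'.
Proof.
move=> lf lf' eqf t.
rewrite (tensE t) (linear_tlift (fun i j => i ⊗ j) t lf).
by rewrite (linear_tlift (fun i j => i ⊗ j) t lf'); apply: eq_tlift.
Qed.

Lemma tlift_id (U V : vectType K) (t : tens U V) : \sw_(a, b <- t) (a ⊗ b) = t.
Proof. by rewrite [RHS]tensE. Qed.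

Lemma tlift_add (U V : vectType K) (W : lmodType K) (F F' : U -> V -> W) t :
  \sw_(a, b <- t) (F a b + F' a b) =
  \sw_(a, b <- t) F a b + \sw_(a, b <- t) F' a b.
Proof.
rewrite /tlift -big_split; apply: eq_bigr => i _ /=.
by rewrite -big_split; apply: eq_bigr => j _ /=; rewrite scalerDr.
Qed.

Lemma tlift_exchange (U V U' V' : vectType K) (W : lmodType K)
    (F : U -> V -> U' -> V' -> W) t t' :
  \sw_(a, b <- t) \sw_(c, d <- t') F a b c d =
  \sw_(c, d <- t') \sw_(a, b <- t) F a b c d.
Proof.
rewrite /tlift !pair_big /=.
under eq_bigr do rewrite pair_big scaler_sumr.
under [RHS]eq_bigr do rewrite pair_big scaler_sumr.
rewrite exchange_big; apply: eq_bigr => i _; apply: eq_bigr => j _ /=.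
by rewrite !scalerA mulrC.
Qed.

Lemma tlift_mull (B C : falgType K) (W : lmodType K) (F : B -> C -> W)
    (b : B) (c : C) t :
  (forall v, linear (F^~ v)) -> (forall u, linear (F u)) ->
  \sw_(p, q <- (b ⊗ c) * t) F p q = \sw_(p, q <- t) F (b * p) (c * q).
Proof.
move=> Fl Fr; move: t; apply: tens_linear_eq => [||u v]; try by lin.
rewrite tensM !tlift_tpure //; move=> u' k x y.
  by rewrite (lin_mulr b (@lin_id _ _)) Fl.
by rewrite (lin_mulr c (@lin_id _ _)) Fr.
Qed.

Lemma tlift_mul (B C : falgType K) (W : lmodType K) (F : B -> C -> W) s t :
  (forall v, linear (F^~ v)) -> (forall u, linear (F u)) ->
  \sw_(p, q <- s * t) F p q =
  \sw_(a, b <- s) \sw_(p, q <- t) F (a * p) (b * q).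
Proof.
move=> Fl Fr; move: s; apply: tens_linear_eq => [||a b]; try by lin.
rewrite tlift_mull // tlift_tpure //.
  by move=> v; apply: lin_tliftF => p q k x y; rewrite mulrDl -scalerAl Fl.
by move=> v; apply: lin_tliftF => p q k x y; rewrite mulrDl -scalerAl Fr.
Qed.

Section Coassoc.

Variables (H : falgType K) (hH : hopf_algebra H) (W : lmodType K).
Variable F : H -> H -> H -> W.
Hypotheses (F1 : forall b c, linear (fun a => F a b c))
  (F2 : forall a c, linear (fun b => F a b c))
  (F3 : forall a b, linear (fun c => F a b c)).

(** A trilinear [F] factors through the triple tensor product, and the induced map is applied to
    both sides of the coassociativity axiom. *)
Lemma sw_coassoc h :
  \sw_(h1, h2 <- comul hH h) \sw_(h11, h12 <- comul hH h1) F h11 h12 h2 =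
  \sw_(h1, h2 <- comul hH h) \sw_(h21, h22 <- comul hH h2) F h1 h21 h22.
Proof.
pose L (t : tens (tens H H) H) := \sw_(p, c <- t) \sw_(a, b <- p) F a b c.
have linL : linear L by rewrite /L; lin.
have Lp a b c : L (a ⊗ b ⊗ c) = F a b c.
  by rewrite /L tlift_tpure; [rewrite tlift_tpure | lin | lin; apply: F3].
have := congr1 L (comul_coassoc hH h); rewrite !(linear_tlift _ _ linL) => E.
apply: etrans (etrans _ E) _; [|symmetry]; apply: eq_tlift => a b;
  by rewrite (linear_tlift _ _ linL); apply: eq_tlift => c d; rewrite Lp.
Qed.

End Coassoc.
End Sweedler.

(** * A presented algebra is spanned by the words in its generators *)

Section Generation.

Variables (K : fieldType) (n : nat).
Variable R : forall B : algType K, B -> ('I_n -> B) -> Prop.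
Hypothesis R_reflect : forall (B C : algType K) (f : {lrmorphism B -> C}) c d,
  injective f -> R (f c) (fun i => f (d i)) -> R c d.
Variables (A : falgType K) (a : A) (b : 'I_n -> A).
Hypothesis presA : presented_by R a b.

Let gens := a :: codom b.

(* The inclusion of the generated subalgebra splits: its section is the lift of
   the generators, and the composite is the identity by uniqueness. *)
Lemma presented_agenv : agenv <<gens>>%VS = fullv.
Proof.
pose C : {aspace A} := ASpace (agenv_is_aspace <<gens>>%VS).
have sub_gen u : u \in gens -> u \in C.
  by move=> us; apply: subvP (memv_span us); apply: sub_agenv.
(* The inclusion of C is a unital morphism only if C has the unit of A. *)
have algidC : algid C = 1.
  by apply/eqP; rewrite algid_eq1 memvE; apply: sub1_agenv.
have valM : monoid_morphism (@vsval K A C) by split.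
pose iota : {lrmorphism subvs_of C -> A} :=
  HB.pack (@vsval K A C)
    (GRing.isMonoidMorphism.Build (subvs_of C) A _ valM).
pose c := Subvs (sub_gen a (mem_head _ _)).
have bC i : b i \in gens by rewrite inE codom_f orbT.
pose d i := Subvs (sub_gen _ (bC i)).
have [|f [fc fd]] := presented_lift presA (c := c) (d := d).
  by apply: (@R_reflect _ _ iota c d); [apply: val_inj | apply: presented_rels presA].
have fK := presented_uniq presA (f := iota \o f) (f' := idfun).
apply/eqP; rewrite eqEsubv subvf; apply/subvP => u _.
by rewrite -[u]fK /= ?fc // => [|i]; [apply: subvsP | rewrite fd].
Qed.

(** The multipliers preserving V are closed under products, and the generators generate all of A. *)
Lemma prodv_gensP (V : {vspace A}) :
  (forall v, v \in V -> a * v \in V) ->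
  (forall i v, v \in V -> b i * v \in V) -> ({:A} * V <= V)%VS.
Proof.
move=> aV bV; rewrite -presented_agenv; apply: agenv_modl.
apply/prodvP => u v gens_u Vv.
rewrite (coord_span (X := in_tuple gens) gens_u) mulr_suml.
apply: memv_suml => i _; rewrite -scalerAl; apply: memvZ.
have: (in_tuple gens)`_i \in gens by rewrite mem_nth.
by rewrite inE => /predU1P[->|/codomP[j ->]]; [apply: aV | apply: bV].
Qed.

Lemma presented_ind (V : {vspace A}) :
  1 \in V -> (forall v, v \in V -> a * v \in V) ->
  (forall i v, v \in V -> b i * v \in V) -> forall u, u \in V.
Proof.
move=> V1 aV bV u; rewrite -[u]mulr1.
by apply: (subvP (prodv_gensP aV bV)); rewrite memv_mul ?memvf.
Qed.

(** Induction on words: the equalizer of [f] and [f'] is a subspace, so [presented_ind] applies. The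
    maps need only be linear, which covers Sweedler identities whose sides are not
    multiplicative. *)
Lemma presented_eq (W : vectType K) (f f' : A -> W) :
  linear f -> linear f' -> f 1 = f' 1 ->
  (forall u, f u = f' u -> f (a * u) = f' (a * u)) ->
  (forall i u, f u = f' u -> f (b i * u) = f' (b i * u)) -> f =1 f'.
Proof.
move=> lf lf' E1 Ea Eb.
have lD : linear (fun u => f u - f' u).
  by move=> k u v; rewrite lf lf' scalerBr opprD addrACA.
pose D : {linear A -> W} :=
  HB.pack (fun u => f u - f' u) (GRing.isLinear.Build K A W *:%R _ lD).
have DP u : (u \in lker (linfun D)) = (f u == f' u).
  by rewrite memv_ker lfunE subr_eq0.
move=> u; apply/eqP; rewrite -DP; move: u; apply: presented_ind.
- by rewrite DP E1.
- by move=> u; rewrite !DP => /eqP/Ea->.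
by move=> i u; rewrite !DP => /eqP/(Eb i)->.
Qed.

End Generation.

(** * Reflecting relations along injective morphisms, as needed to restrict them to a subalgebra *)

Section Relations.

Variables (K : fieldType) (n : nat).

Lemma clifford_rels_reflect (alpha : K) (beta gamma : 'I_n -> K)
    (lambda : 'I_n -> 'I_n -> K) (B C : algType K)
    (f : {lrmorphism B -> C}) c d : injective f ->
  clifford_rels alpha beta gamma lambda (f c) (fun i => f (d i)) ->
  clifford_rels alpha beta gamma lambda c d.
Proof.
move=> f_inj [Gr Xr GXr Lr].
by split=> [|i|i|i j ij]; apply: f_inj;
  rewrite ?(rmorphXn, rmorphD, rmorphM, linearZ, rmorph1) /= ?rmorphM ?rmorph1; auto.
Qed.

Lemma E_rels_reflect (B C : algType K) (f : {lrmorphism B -> C}) c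
    (d : 'I_n -> B) : injective f ->
  E_rels (f c) (fun i => f (d i)) -> E_rels c d.
Proof.
move=> f_inj [Gr Xr GXr Lr].
by split=> [|i|i|i j ij]; apply: f_inj;
  rewrite ?(rmorphXn, rmorphN, rmorphM, rmorph1, rmorph0) /= ?rmorphM; auto.
Qed.

End Relations.

(** * The opposite algebra, as a target for lifts of antimorphisms *)

Section ConverseAlgebra.

Variables (K : fieldType) (B : algType K).

HB.instance Definition _ := GRing.Lmodule.copy B^c B.

Lemma converse_scalerAl (k : K) (u v : B^c) : k *: (u * v) = (k *: u : B^c) * v.
Proof. exact: (scalerAr k (v : B) u). Qed.

HB.instance Definition _ :=
  GRing.Lmodule_isLalgebra.Build K B^c converse_scalerAl.

Lemma converse_scalerAr (k : K) (u v : B^c) : k *: (u * v) = u * (k *: v : B^c).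
Proof. exact: (scalerAl k (v : B) u). Qed.

HB.instance Definition _ :=
  GRing.Lalgebra_isAlgebra.Build K B^c converse_scalerAr.

End ConverseAlgebra.

(** * The inverse antipode of E(n) *)

Section InverseAntipode.

Variables (K : fieldType) (n : nat) (H : falgType K) (hH : hopf_algebra H).
Variables (g : H) (x : 'I_n -> H).
Hypothesis E_H : is_E hH g x.

Let Delta := comul hH.
Let eps := counit hH.

Lemma E_gg : g * g = 1.
Proof. by case: (presented_rels (E_presented E_H)) => /= <-. Qed.

Lemma E_xx i : x i * x i = 0.
Proof. by have [_ xx _ _] := presented_rels (E_presented E_H); exact: xx. Qed.

Lemma E_gx i : g * x i = - (x i * g).
Proof. by case: (presented_rels (E_presented E_H)). Qed.

Lemma E_xx_anti i j : x i * x j = - (x j * x i).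
Proof.
case: (presented_rels (E_presented E_H)) => /= _ _ _ xij.
case: (ltngtP i j) => [/xij //|/xij ->|/val_inj ->]; first by rewrite opprK.
by rewrite E_xx oppr0.
Qed.

(** T is the lift to [H^c] of g and x_i g. It inverts the antipode S on generators: S(x_i g) = S(g)
    S(x_i) = g g x_i = x_i. *)
Lemma E_inverse_antipode_exists : exists T : {linear H -> H},
  [/\ T 1 = 1, forall h k, T (h * k) = T k * T h, T g = g &
      forall i, T (x i) = x i * g].
Proof.
have gxg i : g * (x i * g) = - x i by rewrite mulrA E_gx mulNr -mulrA E_gg mulr1.
have [|T [Tg Tx]] :=
    @presented_lift _ _ _ _ _ _ (E_presented E_H) H^c g (fun i => x i * g).
  split=> [|i|i|i j ij]; rewrite ?expr2.
  - exact: E_gg.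
  (* The patterns unfold a product of [H^c] as the reversed product of [H]. *)
  - rewrite -[LHS]/(x i * g * (x i * g)).
    by rewrite -mulrA gxg mulrN E_xx oppr0.
  - rewrite -[LHS]/(x i * g * g) -[X in _ = - X]/(g * (x i * g)).
    by rewrite gxg opprK -mulrA E_gg mulr1.
  rewrite -[LHS]/(x j * g * (x i * g)) -[X in _ = - X]/(x i * g * (x j * g)).
  by rewrite -!mulrA !gxg !mulrN E_xx_anti.
(* The scalings of [H^c] and [H] coincide, so T is also linear into [H]. *)
have linT : linear (T : H -> H) by move=> k u v; exact: (linearP T k u v).
pose T' : {linear H -> H} :=
  HB.pack (T : H -> H) (GRing.isLinear.Build K H H *:%R _ linT).
exists T'.
split=> //=; first exact: (rmorph1 T).
exact: (rmorphM T).
Qed.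

Variable T : {linear H -> H}.
Hypotheses (T1 : T 1 = 1) (TM : forall h k, T (h * k) = T k * T h).
Hypotheses (Tg : T g = g) (Tx : forall i, T (x i) = x i * g).

Let E_eq W := @presented_eq _ _ _ (@E_rels_reflect K n) _ _ _ (E_presented E_H) W.

(** With [E_comul_mulx], the recursion along words used by the inductions below. *)
Lemma E_comul_mulg (W : lmodType K) (F : H -> H -> W) u :
  (forall v, linear (F^~ v)) -> (forall u, linear (F u)) ->
  \sw_(h1, h2 <- Delta (g * u)) F h1 h2 =
  \sw_(u1, u2 <- Delta u) F (g * u1) (g * u2).
Proof. by move=> Fl Fr; rewrite /Delta rmorphM /= (E_comul_g E_H) tlift_mull. Qed.

Lemma E_comul_mulx (W : lmodType K) (F : H -> H -> W) i u :
  (forall v, linear (F^~ v)) -> (forall u, linear (F u)) ->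
  \sw_(h1, h2 <- Delta (x i * u)) F h1 h2 =
  \sw_(u1, u2 <- Delta u) (F (x i * u1) (g * u2) + F u1 (x i * u2)).
Proof.
move=> Fl Fr; rewrite /Delta rmorphM /= (E_comul_x E_H) mulrDl linearD.
rewrite /= !tlift_mull // -tlift_add.
by apply: eq_tlift => p q; rewrite mul1r.
Qed.

(** T is an antipode for the co-opposite coproduct. In the induction on words, the two terms T(u_2)
    g x_i u_1 and T(u_2) x_i g u_1 produced by x_i cancel. *)
Lemma invantipode_left h : \sw_(h1, h2 <- Delta h) (T h2 * h1) = (eps h)%:A.
Proof.
move: h; apply: E_eq => [||| u IH | i u IH].
- by lin.
- by lin.
- by rewrite /Delta rmorph1 tlift_tpure; [rewrite T1 mulr1 /eps rmorph1 scale1r | lin | lin].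
- rewrite E_comul_mulg; [|lin|lin].
  rewrite /eps rmorphM /= (E_counit_g E_H) mul1r -IH; apply: eq_tlift => u1 u2.
  by rewrite TM Tg -mulrA (mulrA g) E_gg mul1r.
rewrite E_comul_mulx; [|lin|lin].
rewrite /eps rmorphM /= (E_counit_x E_H) mul0r scale0r.
rewrite -[RHS](mul0r (\sw_(u1, u2 <- Delta u) (T u2 * u1))).
rewrite (linear_tlift _ _ (lin_mulr _ (@lin_id _ _))); apply: eq_tlift => u1 u2.
rewrite !TM Tg Tx mul0r -!mulrA (mulrA g) E_gx -mulrDr.
by rewrite mulNr -mulrA addNr mulr0.
Qed.

Lemma invantipode_right h : \sw_(h1, h2 <- Delta h) (h2 * T h1) = (eps h)%:A.
Proof.
move: h; apply: E_eq => [||| u IH | i u IH].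
- by lin.
- by lin.
- by rewrite /Delta rmorph1 tlift_tpure; [rewrite T1 mulr1 /eps rmorph1 scale1r | lin | lin].
- rewrite E_comul_mulg; [|lin|lin].
  rewrite /eps rmorphM /= (E_counit_g E_H) mul1r.
  (* The scalar eps(u) is written as a linear expression in itself, so that [IH] can replace it by a
     sum compared termwise. *)
  have <- : g * ((eps u)%:A * g) = (eps u)%:A.
    by rewrite -scalerAl mul1r -scalerAr E_gg.
  rewrite -IH (linear_tlift (L := fun w => g * (w * g))); last by lin.
  by apply: eq_tlift => u1 u2; rewrite TM Tg !mulrA.
rewrite E_comul_mulx; [|lin|lin].
rewrite /eps rmorphM /= (E_counit_x E_H) mul0r scale0r.
(* The same device with 0 as a linear expression in eps(u), since g x_i g = - x_i. *)
have <- : g * (eps u)%:A * (x i * g) + x i * (eps u)%:A = 0.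
  rewrite -!scalerAr -scalerAl !mulr1 -scalerDr mulrA E_gx.
  by rewrite mulNr -mulrA E_gg mulr1 addNr scaler0.
rewrite -IH (linear_tlift (L := fun w => g * w * (x i * g) + x i * w)); last by lin.
by apply: eq_tlift => u1 u2; rewrite TM Tx !mulrA.
Qed.

(** Replacing u by g u or x_i u multiplies both sides on the right by g ⊗ g or by x_i g ⊗ 1 + g ⊗
    x_i g. *)
Lemma comul_invantipode h :
  Delta (T h) = \sw_(h1, h2 <- Delta h) (T h2 ⊗ T h1).
Proof.
move: h; apply: E_eq => [||| u IH | i u IH].
- by lin.
- by lin.
- by rewrite T1 /Delta rmorph1 tlift_tpure; [rewrite T1 | lin | lin].
- rewrite E_comul_mulg; [|lin|lin].
  rewrite TM /Delta rmorphM /= Tg (E_comul_g E_H) [comul hH (T u)]IH.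
  rewrite (linear_tlift (L := fun w => w * (g ⊗ g))); last by lin.
  by apply: eq_tlift => u1 u2; rewrite !TM Tg tensM.
rewrite E_comul_mulx; [|lin|lin].
rewrite TM /Delta rmorphM /= [comul hH (T u)]IH Tx rmorphM /= (E_comul_g E_H).
rewrite (E_comul_x E_H) mulrDl !tensM E_gg mul1r.
rewrite (linear_tlift (L := fun w => w * (x i * g ⊗ 1 + g ⊗ (x i * g)))); last by lin.
apply: eq_tlift => u1 u2.
by rewrite !TM Tg Tx mulrDr !tensM mulr1 addrC.
Qed.

End InverseAntipode.

(** * A normalized multiplicative Casimir morphism from an inverse antipode *)

Section Separability.

Variables (K : fieldType) (H : falgType K) (hH : hopf_algebra H).
Variable T : {linear H -> H}.

Let Delta := comul hH.
Let eps := counit hH.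

Hypothesis TM : forall h k, T (h * k) = T k * T h.
Hypothesis T_left : forall h,
  \sw_(h1, h2 <- Delta h) (T h2 * h1) = (eps h)%:A.
Hypothesis T_right : forall h,
  \sw_(h1, h2 <- Delta h) (h2 * T h1) = (eps h)%:A.
Hypothesis T_comul : forall h,
  Delta (T h) = \sw_(h1, h2 <- Delta h) (T h2 ⊗ T h1).

Variables (A : falgType K) (cA : comodule_algebra hH A).

Definition invantipode_casimir : {linear tens H H -> tens A H} :=
  tlift (fun h h' => (1 : A) ⊗ (h' * T h)).

Let B := invantipode_casimir.

Lemma invantipode_casimirE h h' : B (h ⊗ h') = 1 ⊗ (h' * T h).
Proof. by rewrite /B /= tlift_tpure //; lin. Qed.

(** Bilinearity: T(g_2 h a_1) = T(a_1) T(h) T(g_2), so a_2 T(a_1) collapses to a counit, and after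
    coassociativity T(g_2) g_1 does too. Colinearity: the second leg of Delta(h' T(h_2)) ends in
    T(h_21), which collapses against h_1. *)
Lemma invantipode_is_casimir : casimir cA B.
Proof.
split=> [a u h h'|h h'].
  rewrite invantipode_casimirE !tensM !mulr1 mul1r.
  have Ea := coact_counit cA a.
  rewrite -[X in _ = X ⊗ _]Ea.
  rewrite (linear_tlift (L := fun w => w ⊗ (u * (h' * T h)))); last by lin.
  apply: eq_tlift => a0 a12.
  transitivity (\sw_(u1, u23 <- Delta u) \sw_(u2, u3 <- Delta u23)
     (a0 ⊗ (u3 * h' * (eps a12)%:A * T h * T u2 * u1))).
    rewrite -T_right.
    rewrite (linear_tlift (L := fun w => \sw_(u1, u23 <- Delta u)
     \sw_(u2, u3 <- Delta u23) (a0 ⊗ (u3 * h' * w * T h * T u2 * u1)))); last by lin.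
    apply: eq_tlift => a1 a2; apply: eq_tlift => u1 u23; apply: eq_tlift => u2 u3.
    by rewrite invantipode_casimirE !tensM !mulr1 mul1r !TM !mulrA.
  rewrite -(sw_coassoc hH (F := fun u1 u2 u3 =>
     a0 ⊗ (u3 * h' * (eps a12)%:A * T h * T u2 * u1))); [|by lin..].
  rewrite tpureZl -tpureZr -[in RHS](counit_left hH u).
  rewrite (linear_tlift (L := fun w => a0 ⊗ (eps a12 *: (w * (h' * T h))))); last by lin.
  apply: eq_tlift => u12 u3.
  (* The counit factor is moved to the right end, where [T_left] expands it. *)
  have -> : a0 ⊗ (eps a12 *: (counit hH u12 *: u3 * (h' * T h))) =
     a0 ⊗ (u3 * h' * (eps a12)%:A * T h * (counit hH u12)%:A).
    rewrite -!scalerAr -!scalerAl !mulr1 scalerA mulrC -scalerA.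
    by rewrite -!mulrA.
  rewrite -(T_left u12).
  rewrite (linear_tlift (L := fun w => a0 ⊗ (u3 * h' * (eps a12)%:A * T h * w)));
    last by lin.
  by apply: eq_tlift => u1 u2; rewrite !mulrA.
(* The coaction on 1 is trivial, and [T_comul] splits the coproduct of h' T(h_2). *)
transitivity (\sw_(h1, h2 <- Delta h) \sw_(h21, h22 <- Delta h2)
   \sw_(p, q <- Delta h') ((1 : A) ⊗ (p * T h22) ⊗ (q * T h21 * h1))).
  apply: eq_tlift => h1 h2; rewrite invantipode_casimirE tlift_tpure; [|lin|lin].
  rewrite rmorph1 tlift_tpure; [|lin|lin].
  rewrite rmorphM /= tlift_mul; [|by lin..].
  rewrite -[comul hH (T h2)]/(Delta (T h2)) T_comul tlift_exchange.
  rewrite (linear_tlift (L := fun t => \sw_(p, q <- t) \sw_(a, b <- Delta h')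
    ((1 : A) ⊗ (a * p) ⊗ (b * q * h1 * 1)))); last by lin.
  apply: eq_tlift => h21 h22; rewrite tlift_tpure; [|by lin..].
  by apply: eq_tlift => p q; rewrite mulr1.
rewrite -(sw_coassoc hH (F := fun h1 h21 h22 =>
  \sw_(p, q <- Delta h') ((1 : A) ⊗ (p * T h22) ⊗ (q * T h21 * h1)))); [|by lin..].
rewrite -[in RHS](counit_left hH h).
rewrite (linear_tlift (L := fun w =>
  \sw_(p, q <- Delta h') (B (w ⊗ p) ⊗ q))); last by lin.
apply: eq_tlift => h12 h3.
rewrite tlift_exchange; apply: eq_tlift => p q.
have -> : B ((counit hH h12 *: h3) ⊗ p) ⊗ q =
   1 ⊗ (p * T h3) ⊗ (q * (counit hH h12)%:A).
  by rewrite invantipode_casimirE linearZ -!scalerAr mulr1 !(tpureZr, tpureZl).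
rewrite -(T_left h12) (linear_tlift (L := fun w => 1 ⊗ (p * T h3) ⊗ (q * w))); last by lin.
by apply: eq_tlift => h1 h2; rewrite mulrA.
Qed.

Lemma invantipode_normalized : normalized hH B.
Proof.
move=> h; rewrite /B /= -(linear_tlift _ _ (lin_tpurer _ (@lin_id _ _))) T_right.
exact: tpureZr.
Qed.

(** The inner factors of h'' T(h'_2) h'_1 T(h) collapse to eps(h'). *)
Lemma invantipode_multiplicative (h h' h'' : H) :
  \sw_(h'1, h'2 <- Delta h')
    \sw_(b, l <- B (h ⊗ h'1)) \sw_(c, m <- B (h'2 ⊗ h'')) ((b * c) ⊗ (m * l))
  = eps h' *: B (h ⊗ h'').
Proof.
rewrite invantipode_casimirE.
have -> : eps h' *: ((1 : A) ⊗ (h'' * T h)) = 1 ⊗ (h'' * (eps h')%:A * T h).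
  by rewrite -scalerAr mulr1 -scalerAl tpureZr.
rewrite -T_left (linear_tlift (L := fun w => (1 : A) ⊗ (h'' * w * T h))); last by lin.
apply: eq_tlift => h1 h2; rewrite !invantipode_casimirE.
rewrite tlift_tpure; [|lin|lin]; rewrite tlift_tpure; [|lin|lin].
by rewrite mulr1 !mulrA.
Qed.

End Separability.

(** * Semisimplicity of a Clifford algebra with an invertible element anticommuting with the
    generators *)

Section Clifford.

Variables (K : fieldType) (n : nat) (alpha : K) (beta gamma : 'I_n -> K).
Variables (lambda : 'I_n -> 'I_n -> K) (A : falgType K) (G : A) (X : 'I_n -> A).
Hypothesis presA :
  presented_by (@clifford_rels K n alpha beta gamma lambda) G X.
Hypothesis two_neq0 : 2%:R != 0 :> K.

Let gens := G :: codom X.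
Let V := <<gens>>%VS.

Let A_eq W := @presented_eq _ _ _
  (@clifford_rels_reflect K n alpha beta gamma lambda) _ _ _ presA W.

Lemma double_eq0 (B : lmodType K) (y : B) : y + y = 0 -> y = 0.
Proof.
by move/eqP; rewrite -mulr2n -scaler_nat scaler_eq0 (negPf two_neq0) => /eqP.
Qed.

Lemma span_linear_eq (s : seq A) (f : A -> A) :
  linear f -> (forall y, y \in s -> f y = 0) -> forall y, y \in <<s>>%VS -> f y = 0.
Proof.
move=> lf fs y sy.
pose f' : {linear A -> A} := HB.pack f (GRing.isLinear.Build K A A *:%R f lf).
rewrite (coord_span (X := in_tuple s) sy) -[f]/(f' : _ -> _) linear_sum big1 // => i _.
by rewrite linearZ /= fs ?scaler0 // mem_nth.
Qed.

Lemma clifford_mem_gens (P : A -> Prop) :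
  P G -> (forall i, P (X i)) -> forall y, y \in gens -> P y.
Proof. by move=> PG PX y; rewrite inE => /predU1P[->|/codomP[i ->]]. Qed.

(** This is the polar form of the quadratic form y y on V; bilinearity reduces it to generators,
    where the relations apply. *)
Lemma clifford_form y z : y \in V -> z \in V -> y * z + z * y \in 1%VS.
Proof.
have [/= GG XX GX XX'] := presented_rels presA.
have one k : k%:A \in (1%VS : {vspace A}) by apply: memvZ; apply: memv_line.
have gg y' z' : y' \in gens -> z' \in gens -> y' * z' + z' * y' \in 1%VS.
  move: y'; apply: clifford_mem_gens => [|i]; move: z'; apply: clifford_mem_gens => [|j].
  - by rewrite memvD // -expr2 GG.
  - by rewrite GX.
  - by rewrite addrC GX.
  case: (ltngtP i j) => [/XX' -> //|/XX'|/val_inj ->]; last by rewrite memvD // -expr2 XX.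
  by rewrite addrC => ->.
move=> sy sz.
rewrite (coord_span (X := in_tuple gens) sy) (coord_span (X := in_tuple gens) sz).
rewrite mulr_suml mulr_sumr -big_split; apply: memv_suml => i _ /=.
rewrite mulr_sumr mulr_suml -big_split; apply: memv_suml => j _ /=.
rewrite -!scalerAl -!scalerAr [X in _ + X]scalerA [X in _ + X *: _]mulrC.
by rewrite -scalerA -!scalerDr !memvZ // gg // mem_nth.
Qed.

Section Nondegenerate.

Variables u v : A.
Hypotheses (uv : u * v = 1) (Gu : G * u = - (u * G)).
Hypothesis Xu : forall i, X i * u = - (u * X i).

(* Let s be the parity automorphism, so that y u = u s(y) for all y, and let
   o = u - s(u) be twice the odd part of u.  Then o o = 0, and a vector r in the
   radical satisfies 2 u r = o r, hence o u r = 0 = u o r, hence r = 0. *)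
Lemma clifford_nondegenerate r : r \in V ->
  (forall y, y \in V -> r * y + y * r = 0) -> r = 0.
Proof.
move=> Vr r_orth.
(* The right inverse v makes right multiplication by u injective, hence bijective in finite
   dimension. *)
have [w wu] : exists w, w * u = 1.
  have inj_u : lker (amulr u) == 0%VS.
    apply/lker0P => y z; rewrite !lfunE /= => /(congr1 (fun t => t * v)).
    by rewrite -!mulrA uv !mulr1.
  by exists ((amulr u)^-1%VF 1); have:= lker0_lfunVK inj_u 1; rewrite lfunE.
have u_inj y : u * y = 0 -> y = 0.
  by move/(congr1 (fun t => w * t)); rewrite mulrA wu mul1r mulr0.
(* All relations are even in the generators, so negating the generators preserves them. *)
have [|s [sG sX]] :=
    presented_lift presA (B := A) (c := - G) (d := fun i => - X i).
  have [/= GG XX GX XX'] := presented_rels presA.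
  by split=> [|i|i|i j ij]; rewrite ?sqrrN // ?mulrNN //; auto.
have ssG : s (s G) = G by rewrite sG rmorphN /= sG opprK.
have ssX i : s (s (X i)) = X i by rewrite sX rmorphN /= sX opprK.
have ss y : s (s y) = y.
  exact: (presented_uniq presA (f := s \o s) (f' := idfun) ssG ssX y).
have us y : y * u = u * s y.
  move: y; apply: A_eq => [|||y IH|i y IH]; try by lin.
  - by rewrite rmorph1 mul1r mulr1.
  - by rewrite rmorphM /= sG -mulrA IH mulrA Gu !mulNr mulrN mulrA.
  by rewrite rmorphM /= sX -mulrA IH mulrA Xu !mulNr mulrN mulrA.
have sus y : y * s u = s u * s y by rewrite -[y in LHS]ss -!rmorphM us ss.
(* A vector orthogonal to V anticommutes with the generators, hence passes through words up to
   parity. *)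
have rs y : r * y = s y * r.
  have Vg z : z \in gens -> r * z = - (z * r).
    by move=> gz; apply/eqP; rewrite -addr_eq0 r_orth // memv_span.
  move: y; apply: A_eq => [|||y IH|i y IH]; try by lin.
  - by rewrite rmorph1 mul1r mulr1.
  - by rewrite rmorphM /= sG mulrA Vg ?mem_head // mulNr -(mulrA G r) IH !mulNr mulrA.
  have gX : X i \in gens by rewrite inE codom_f orbT.
  by rewrite rmorphM /= sX mulrA Vg // mulNr -(mulrA _ r) IH !mulNr mulrA.
have ru : r * u = - (u * r).
  have lf : linear (fun y => y * u + u * y) by lin.
  apply/eqP; rewrite -addr_eq0; apply/eqP.
  apply: (span_linear_eq lf) Vr; apply: clifford_mem_gens => [|i].
    by rewrite Gu addNr.
  by rewrite Xu addNr.
pose o := u - s u.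
have os y : y * o = o * s y by rewrite /o mulrBr mulrBl us sus.
have so : s o = - o by rewrite /o rmorphB /= ss opprB.
(* By [os] at o itself, o o = o s(o) = - o o. *)
have oo : o * o = 0.
  by apply: double_eq0; rewrite {1}os so mulrN addNr.
have our : u * r + u * r = o * r.
  by rewrite /o mulrBl -rs ru opprK.
(* Since o u = u s(o) = - u o, the vanishing of o (u r + u r) says that 2 u o r = 0. *)
have or0 : o * r = 0.
  apply: u_inj; apply: double_eq0; apply/eqP.
  have : o * (u * r + u * r) = 0 by rewrite our mulrA oo mul0r.
  by rewrite mulrDr !mulrA us so mulrN mulNr -opprD => /eqP; rewrite oppr_eq0.
by apply: u_inj; apply: double_eq0; rewrite our.
Qed.

End Nondegenerate.

Let anticomm (y z : A) := y * z + z * y == 0.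

(** Gram-Schmidt by induction on the dimension: unless a basis is already orthogonal, split off a
    vector w with w w nonzero and recurse on its orthogonal complement in W. *)
Lemma clifford_orthogonal_span W : (W <= V)%VS ->
  exists2 s : seq A, <<s>>%VS = W & pairwise anticomm s.
Proof.
move: {2}(\dim W).+1 (ltnSn (\dim W)) => m; elim: m W => // m IH W.
rewrite ltnS => dimW sWV.
have [pw|npw] := boolP (pairwise anticomm (vbasis W)).
  by exists (vbasis W) => //; apply: span_basis (vbasisP W).
(* Polarization: if y y = z z = 0 but y and z do not anticommute, then (y + z)(y + z) = y z + z y is
   nonzero. *)
have [w Ww ww] : exists2 w, w \in W & w * w != 0.
  suff key (l : seq A) : (forall y, y \in l -> y \in W) ->
      ~~ pairwise anticomm l -> exists2 w, w \in W & w * w != 0.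
    by apply: key npw => y; apply: vbasis_mem.
  elim: l => //= y l IHl sub.
  have subl z : z \in l -> z \in W by move=> lz; apply: sub; rewrite inE lz orbT.
  rewrite negb_and => /orP[|/(IHl subl)//].
  rewrite -has_predC => /hasP[z lz /= yz].
  have Wy : y \in W by apply: sub; rewrite mem_head.
  have Wz := subl _ lz.
  have [y2|] := eqVneq (y * y) 0; last by exists y.
  have [z2|] := eqVneq (z * z) 0; last by exists z.
  exists (y + z); first exact: memvD.
  by rewrite mulrDl !mulrDr y2 z2 add0r addr0.
have W1 y z : y \in W -> z \in W -> exists k, y * z + z * y = k%:A.
  move=> /(subvP sWV) Vy /(subvP sWV) Vz.
  by have /vlineP[k Ek] := clifford_form Vy Vz; exists k.
have [c Ec] := W1 _ _ Ww Ww.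
have c0 : c != 0.
  apply: contraNneq ww => c0; move: Ec; rewrite c0 scale0r.
  by move=> /double_eq0 ->.
pose W' := (W :&: lker (amull w + amulr w)%R)%VS.
have W'P z : (z \in W') = (z \in W) && (w * z + z * w == 0).
  by rewrite memv_cap memv_ker add_lfunE !lfunE.
have w_notin : w \notin W'.
  by rewrite W'P Ww; apply: contraNN ww => /eqP/double_eq0->.
have W'W : (W' <= W)%VS by apply: capvSl.
have dimW' : (\dim W' < m)%N.
  apply: leq_trans dimW; rewrite ltn_neqAle dimvS // andbT.
  apply: contraNneq w_notin => dimE.
  have /eqP -> : W' == W by rewrite eqEdim W'W dimE leqnn.
  exact: Ww.
have [s sW' pw] := IH W' dimW' (subv_trans W'W sWV).
exists (w :: s); last first.
  rewrite /= pw andbT; apply/allP => z /memv_span; rewrite sW' W'P.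
  by case/andP.
apply/eqP; rewrite span_cons sW' eqEsubv subv_add -memvE Ww W'W.
apply/subvP => z Wz; have [k Ek] := W1 _ _ Ww Wz.
(* The component of z along w: the polar form with w gives k on z and c on w. *)
apply/memv_addP; exists ((k / c) *: w); first by rewrite memvZ ?memv_line.
exists (z - (k / c) *: w); last by rewrite addrC subrK.
rewrite W'P memvB ?memvZ //= mulrBr mulrBl -scalerAr -scalerAl.
by rewrite addrACA -opprD -scalerDr Ek Ec scalerA divfK // subrr.
Qed.

(* Averaging p over a further anticommuting unit e, as (p + e^-1 p e) / 2, keeps
   the commutation with the previous ones. *)
Lemma maschke_projection (U : {vspace A}) s :
  ({:A} * U <= U)%VS -> pairwise anticomm s ->
  {in s, forall e, e = 0 \/ exists2 c : K, c != 0 & e * e = c%:A} ->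
  exists p : A -> A, [/\ linear p, forall y, p y \in U,
    {in U, forall y, p y = y} & {in s, forall e y, p (e * y) = e * p y}].
Proof.
move=> idlU; elim: s => [|e s IH] /=.
  exists (projv U); split=> // [|y|y]; 
    [exact: linearP | exact: memv_proj | exact: projv_id].
case/andP=> /allP es /IH{}IH sqr.
have [|p [lp pU Up ps]] := IH; first by move=> f sf; apply: sqr; rewrite inE sf orbT.
have [e0|[c c0 ee]] := sqr e (mem_head _ _).
  exists p; split=> // f; rewrite inE => /predU1P[->|/ps //] y.
  by rewrite e0 !mul0r; have := lp (-1) 0 0; rewrite scaler0 addr0 scaleN1r addNr.
(* Since e e = c, the inverse of e is c^-1 e. *)
pose q y := 2%:R^-1 *: (p y + c^-1 *: (e * p (e * y))).
have U_mul a y : y \in U -> a * y \in U.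
  by move=> Uy; apply: (subvP idlU); rewrite memv_mul ?memvf.
have half (y : A) : 2%:R^-1 *: (y + y) = y.
  by rewrite -mulr2n -scaler_nat scalerA mulVf ?scale1r.
have lp_mull a : linear (fun y => p (a * y)).
  by move=> k y z; rewrite mulrDr -scalerAr lp.
have ec y : e * (e * y) = c *: y by rewrite mulrA ee -scalerAl mul1r.
have pZ k y : p (k *: y) = k *: p y.
  have p0 : p 0 = 0 by have := lp (-1) 0 0; rewrite scaler0 addr0 scaleN1r addNr.
  by have := lp k y 0; rewrite p0 !addr0.
have pN y : p (- y) = - p y by rewrite -scaleN1r pZ scaleN1r.
exists q; split=> [|y|y Uy|f sf y].
- by rewrite /q; lin; apply: lp_mull.
- by rewrite /q memvZ // memvD ?memvZ ?U_mul ?pU.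
- by rewrite /q !Up ?U_mul // ec scalerA mulVf // scale1r half.
rewrite /q; move: sf; rewrite inE => /predU1P[->|sf].
  rewrite ec pZ -scalerAr scalerA mulVf // scale1r addrC.
  by rewrite -scalerAr mulrDr -scalerAr ec scalerA mulVf // scale1r.
(* Moving f past the two occurrences of e produces two signs, which cancel. *)
have ef : e * f = - (f * e) by apply/eqP; rewrite -addr_eq0; apply: es.
rewrite -scalerAr mulrDr ps // -scalerAr; congr (_ *: (_ + _ *: _)).
by rewrite [e * (f * y)]mulrA ef mulNr pN mulrN -(mulrA f) ps // mulrA ef mulNr opprK mulrA.
Qed.

(** A projection onto U commuting with left multiplication by V does so for the generators, so its
    kernel is a left ideal complementing U. *)
Lemma clifford_semisimple u v : u * v = 1 -> G * u = - (u * G) ->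
  (forall i, X i * u = - (u * X i)) -> semisimple A.
Proof.
move=> uv Gu Xu U idlU.
have [s sV pw] := clifford_orthogonal_span (subvv V).
have anti e y : e \in s -> y \in s -> e != y -> e * y + y * e = 0.
  elim: s {sV} pw => //= z s IH /andP[/allP zs pw].
  rewrite !inE => /predU1P[->|se] /predU1P[->|sy] //; last exact: IH.
  - by rewrite eqxx.
  - by move=> _; apply/eqP; apply: zs.
  by move=> _; rewrite addrC; apply/eqP; apply: zs.
have sqr : {in s, forall e, e = 0 \/ exists2 c : K, c != 0 & e * e = c%:A}.
  move=> e se; have Ve : e \in V by rewrite -sV memv_span.
  have /vlineP[k Ek] := clifford_form Ve Ve.
  (* If e e + e e = 0, then e is orthogonal to the whole family, hence to V, and nondegeneracy gives
     e = 0. *)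
  have [k0|k0] := eqVneq k 0; [left | right].
    apply: (clifford_nondegenerate uv Gu Xu Ve); rewrite -sV.
    have le : linear (fun y => e * y + y * e) by lin.
    apply: (span_linear_eq le) => z sz.
    have [<-|] := eqVneq e z; first by rewrite Ek k0 scale0r.
    exact: anti.
  (* Here k is e e + e e, whence the half. *)
  exists (k / 2%:R); first by rewrite mulf_neq0 ?invr_eq0.
  rewrite mulrC -scalerA -Ek -mulr2n -scaler_nat scalerA mulVf // scale1r //.
have [p [lp pU Up ps]] := maschke_projection idlU pw sqr.
have pV e y : e \in V -> p (e * y) = e * p y.
  rewrite -sV => Ve; apply/eqP; rewrite -subr_eq0; apply/eqP.
  have ld : linear (fun e => p (e * y) - e * p y).
    by move=> k a b; rewrite mulrDl -scalerAl lp mulrDl -scalerAl scalerBr opprD addrACA.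
  by apply: (span_linear_eq ld) Ve => f sf; rewrite ps // subrr.
pose P : {linear A -> A} := HB.pack p (GRing.isLinear.Build K A A *:%R p lp).
have kerP y : (y \in lker (linfun P)) = (p y == 0) by rewrite memv_ker lfunE.
exists (lker (linfun P)); split.
- apply: (prodv_gensP (@clifford_rels_reflect K n alpha beta gamma lambda) presA).
    by move=> y; rewrite !kerP pV ?memv_span ?mem_head // => /eqP->; rewrite mulr0.
  move=> i y; rewrite !kerP pV => [/eqP->|]; first by rewrite mulr0.
  by rewrite memv_span // inE codom_f orbT.
- apply/eqP; rewrite eqEsubv subvf; apply/subvP => y _.
  apply/memv_addP; exists (p y); first exact: pU.
  exists (y - p y); last by rewrite addrC subrK.
  by rewrite kerP -[p _]/(P _) linearB /= (Up (p y)) ?subrr.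
apply/eqP; rewrite -subv0; apply/subvP => y.
rewrite memv_cap kerP memv0 => /andP[Uy].
by rewrite Up.
Qed.

End Clifford.

(** * Left integrals of E(n) *)

Section Integrals.

Variables (K : fieldType) (n : nat) (H : falgType K) (hH : hopf_algebra H).
Variables (g : H) (x : 'I_n -> H).
Hypothesis E_H : is_E hH g x.

(* D is an entry of a lift of E(n) to 2 x 2 matrices: x_j is sent to
   [[-x_j, delta_ij], [0, x_j]] and g to [[-g, 0], [0, g]]. *)
Lemma E_skew_derivation i : exists D : H -> H,
  linear D /\ forall j u, D (x j * u) = (j == i)%:R *: u - x j * D u.
Proof.
pose E : 'M[K]_2 := delta_mx 0 1.
pose J : 'M[K]_2 := delta_mx 1 1 - delta_mx 0 0.
have JJ : J * J = 1.
  apply/matrixP => a b; rewrite !mxE !big_ord_recl big_ord0 !mxE.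
  by case: a => [[|[|a]] ?] //; case: b => [[|[|b]] ?] //=;
    rewrite ?(mulr0, mul0r, mulrNN, subr0, sub0r, addr0, add0r, mulr1).
have EE : E * E = 0 by rewrite /E -[LHS]/(_ *m _) mul_delta_mx_0.
have EJ : E * J = - (J * E).
  rewrite /J mulrBr mulrBl -![_ * _]/(_ *m _) !mul_delta_mx !mul_delta_mx_0 //.
  by rewrite subr0 sub0r opprK.
have ord2 : lift ord0 ord0 = 1 :> 'I_2 by apply: val_inj.
have J1m (m : 'M[K]_2) : (J * m) 1 1 = m 1 1.
  rewrite !mxE !big_ord_recl big_ord0 !mxE /= !subr0 ord2.
  by rewrite mul0r mul1r add0r addr0.
have J0m (m : 'M[K]_2) : (J * m) 0 1 = - m 0 1.
  rewrite !mxE !big_ord_recl big_ord0 !mxE /= !sub0r.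
  by rewrite oppr0 mul0r mulN1r !addr0.
have E1m (m : 'M[K]_2) : (E * m) 1 1 = 0.
  by rewrite !mxE !big_ord_recl big_ord0 !mxE /= !mul0r !addr0.
have E0m (m : 'M[K]_2) : (E * m) 0 1 = m 1 1.
  rewrite !mxE !big_ord_recl big_ord0 !mxE /= ord2.
  by rewrite mul0r mul1r add0r addr0.
(* From here on only the relations of E and J and the entry formulas above are used. *)
clearbody E J.
have tN (m : 'M[K]_2) (h : H) : (- m) ⊗ h = - (m ⊗ h).
  by rewrite -scaleN1r tpureZl scaleN1r.
have t0 (m : 'M[K]_2) : m ⊗ (0 : H) = 0 by rewrite -(scale0r 0) tpureZr scale0r.
have t0' (h : H) : (0 : 'M[K]_2) ⊗ h = 0 by rewrite -(scale0r 0) tpureZl scale0r.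
have tNr (m : 'M[K]_2) (h : H) : m ⊗ (- h) = - (m ⊗ h).
  by rewrite -scaleN1r tpureZr scaleN1r.
pose c : tens 'M[K]_2 H := J ⊗ g.
pose d j : tens 'M[K]_2 H := J ⊗ x j + (j == i)%:R *: (E ⊗ 1).
have dd j k : d j * d k = 1 ⊗ (x j * x k)
    + ((k == i)%:R *: ((J * E) ⊗ x j) - (j == i)%:R *: ((J * E) ⊗ x k)).
  rewrite /d !mulrDl !mulrDr -!scalerAl -!scalerAr !tensM JJ EE !mulr1 !mul1r.
  by rewrite EJ t0' !scaler0 addr0 tN scalerN addrA.
have cc : c * c = 1 by rewrite /c tensM JJ (E_gg E_H).
have cd j : c * d j = 1 ⊗ (g * x j) + (j == i)%:R *: ((J * E) ⊗ g).
  by rewrite /c /d mulrDr -scalerAr !tensM JJ mulr1.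
have dc j : d j * c = 1 ⊗ (x j * g) - (j == i)%:R *: ((J * E) ⊗ g).
  by rewrite /c /d mulrDl -scalerAl !tensM JJ mul1r EJ tN scalerN.
have [|f [fg fx]] := presented_lift (E_presented E_H) (c := c) (d := d).
  split=> [|j|j|j k _]; rewrite ?expr2 //.
  - by rewrite dd subrr addr0 (E_xx E_H) t0.
  - by rewrite cd dc (E_gx E_H) tNr opprD opprK.
  by rewrite !dd (E_xx_anti E_H) tNr !opprD opprK; congr (_ + _); rewrite addrC.
(* [en a] reads the right column of a 2 x 2 matrix over H. *)
pose en (a : 'I_2) (t : tens 'M[K]_2 H) :=
  \sw_(m, h <- t) ((m : 'M[K]_2) a 1 *: h).
have lin_entry a b : linear (fun m : 'M[K]_2 => m a b : K^o).
  by move=> k m m'; rewrite !mxE.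
have en_lin a : linear (en a) by rewrite /en; lin.
have en_mul a m h t :
    en a ((m ⊗ h) * t) = \sw_(m', h' <- t) ((m * m') a 1 *: (h * h')).
  by rewrite /en tlift_mull //; lin; apply: lin_entry.
have en1J h t : en 1 ((J ⊗ h) * t) = h * en 1 t.
  rewrite en_mul (linear_tlift _ _ (lin_mulr _ (@lin_id _ _))).
  by apply: eq_tlift => m' h'; rewrite J1m scalerAr.
have en0J h t : en 0 ((J ⊗ h) * t) = - (h * en 0 t).
  have lN : linear (fun w : H => - (h * w)).
    by move=> k u v; rewrite mulrDr -scalerAr opprD scalerN.
  rewrite en_mul (linear_tlift _ _ lN).
  by apply: eq_tlift => m' h'; rewrite J0m -scalerAr scaleNr.
have en1E t : en 1 ((E ⊗ 1) * t) = 0.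
  rewrite en_mul -(mul0r (en 0 t)) (linear_tlift _ _ (lin_mulr _ (@lin_id _ _))).
  by apply: eq_tlift => m' h'; rewrite E1m scale0r mul0r.
have en0E t : en 0 ((E ⊗ 1) * t) = en 1 t.
  by rewrite en_mul; apply: eq_tlift => m' h'; rewrite E0m mul1r.
have enD a s t : en a (s + t) = en a s + en a t.
  by have := en_lin a 1 s t; rewrite !scale1r.
have enZ a k t : en a (k *: t) = k *: en a t.
  have e0 : en a 0 = 0 by have := en_lin a (-1) 0 0; rewrite scaler0 addr0 scaleN1r addNr.
  by have := en_lin a k t 0; rewrite e0 !addr0.
(* The lower right entry of the lift is the identity, so the upper right entry obeys the skew
   Leibniz rule. *)
have f1 : en 1 \o f =1 id.
  apply: (presented_eq (@E_rels_reflect K n) (E_presented E_H)) => /= [||| u IH|j u IH].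
  - by move=> k u v; rewrite /= linearP en_lin.
  - by [].
  - rewrite rmorph1 tens1E /en tlift_tpure; [|by lin; apply: lin_entry..].
    by rewrite mxE eqxx scale1r.
  - by rewrite rmorphM /= fg en1J IH.
  by rewrite rmorphM /= fx mulrDl enD en1J -scalerAl enZ en1E scaler0 addr0 IH.
exists (en 0 \o f); split=> [k u v|j u]; first by rewrite /= linearP en_lin.
rewrite /= rmorphM /= fx mulrDl enD en0J -scalerAl enZ en0E addrC.
by rewrite [en 1 _]f1.
Qed.

Lemma E_gprod (l : seq 'I_n) :
  g * \prod_(i <- l) x i = (-1) ^+ size l *: (\prod_(i <- l) x i * g).
Proof.
elim: l => [|i l IH]; first by rewrite big_nil mulr1 mul1r scale1r.
rewrite big_cons mulrA (E_gx E_H) mulNr -(mulrA (x i) g) IH -scalerAr mulrA.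
by rewrite /= exprS mulN1r scaleNr.
Qed.

Lemma E_xprod (l : seq 'I_n) i :
  x i * \prod_(j <- l) x j = (-1) ^+ size l *: (\prod_(j <- l) x j * x i).
Proof.
elim: l => [|j l IH]; first by rewrite big_nil mulr1 mul1r scale1r.
rewrite big_cons mulrA (E_xx_anti E_H) mulNr -(mulrA (x j) (x i)) IH -scalerAr mulrA.
by rewrite /= exprS mulN1r scaleNr.
Qed.

(** Moving x_i left through the tail, at the cost of a sign, creates the square x_i x_i = 0. *)
Lemma E_prodx (l : seq 'I_n) i : i \in l -> \prod_(j <- l) x j * x i = 0.
Proof.
elim: l => // j l IH; rewrite inE big_cons -mulrA => /predU1P[->|/IH ->].
  have sgn2 m (y : H) : (-1) ^+ m *: ((-1) ^+ m *: y) = y.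
    by rewrite scalerA -exprMn mulrNN mulr1 expr1n scale1r.
  rewrite -[\prod_(_ <- _) _ * _](sgn2 (size l)) -E_xprod -scalerAr mulrA.
  by rewrite (E_xx E_H) mul0r scaler0.
by rewrite mulr0.
Qed.

(** Applying the skew derivation D for i to x_i c = 0 gives c = x_i D(c); applying it to x_j c = 0
    shows that D(c) is still killed by the other x_j. *)
Lemma E_annihilated_factor (l : seq 'I_n) c :
  uniq l -> (forall i, i \in l -> x i * c = 0) ->
  exists w, c = \prod_(i <- l) x i * w.
Proof.
elim: l c => [|i l IH] c /=; first by exists c; rewrite big_nil mul1r.
case/andP=> il ul xc; have [D [linD DE]] := E_skew_derivation i.
have D0 : D 0 = 0 by have := linD (-1) 0 0; rewrite scaler0 addr0 scaleN1r addNr.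
have cE : c = x i * D c.
  have := DE i c; rewrite xc ?mem_head // D0 eqxx scale1r.
  by move/esym/eqP; rewrite subr_eq0 => /eqP.
have [|w Dw] := IH (D c) ul.
  move=> j lj; have := DE j c; rewrite xc ?inE ?lj ?orbT // D0.
  have /negPf -> : j != i by apply: contraNneq il => <-.
  by rewrite scale0r sub0r => /esym/eqP; rewrite oppr_eq0 => /eqP.
by exists w; rewrite big_cons -mulrA -Dw.
Qed.

(** Put P = x_1 ... x_n. An element c killed by all x_i is P w, which lies in the span of P and P g
    because P x_i = 0. Then g c = c and g P = - P g, where n odd enters, leave only the multiples of
    P (1 - g). *)
Lemma E_left_integral : odd n -> 2%:R != 0 :> K ->
  exists lam : H, [/\ lam * g = - lam, forall i, lam * x i = 0 &
    forall c, g * c = c -> (forall i, x i * c = 0) -> exists k, c = k *: lam].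
Proof.
move=> odd_n two_neq0; pose l := enum 'I_n.
pose P := \prod_(i <- l) x i.
have Px i : P * x i = 0 by apply: E_prodx; rewrite mem_enum.
have gP : g * P = - (P * g).
  by rewrite /P E_gprod size_enum_ord -signr_odd odd_n scaleN1r.
exists (P * (1 - g)); split=> [|i|c gc xc].
- by rewrite mulrBr mulr1 mulrBl -mulrA (E_gg E_H) mulr1 opprB.
- by rewrite -mulrA mulrBl mul1r (E_gx E_H) opprK mulrDr mulrA Px mul0r addr0.
have [|w cw] := E_annihilated_factor (enum_uniq 'I_n) (c := c).
  by move=> i _; apply: xc.
pose S := (<[P]> + <[P * g]>)%VS.
have PgS : P * g \in S by apply: (subvP (addvSr _ _)); apply: memv_line.
have PS : P \in S by apply: (subvP (addvSl _ _)); apply: memv_line.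
(* Replacing y by g y swaps P y and P g y, so the induction tracks both. *)
pose Q := (amull P @^-1: S :&: amull (P * g) @^-1: S)%VS.
have QP y : (y \in Q) = (P * y \in S) && (P * g * y \in S).
  by rewrite memv_cap -!memv_preim !lfunE.
have: w \in Q.
  apply: (presented_ind (@E_rels_reflect K n) (E_presented E_H)) => [|y|i y].
  - by rewrite QP !mulr1 PS PgS.
  - by rewrite !QP !mulrA => /andP[Py ->]; rewrite -(mulrA P g g) (E_gg E_H) mulr1 Py.
  rewrite !QP !mulrA Px -(mulrA P g (x i)) (E_gx E_H) mulrN mulrA Px.
  by rewrite !(mul0r, oppr0) mem0v.
rewrite QP => /andP[/memv_addP[_ /vlineP[a ->] [_ /vlineP[b ->] Pw]] _].
exists ((a - b) / 2%:R).
have cE : c = a *: P + b *: (P * g) by rewrite cw -Pw.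
(* One copy of c is replaced by g c, which antisymmetrizes the coefficients. *)
have c2 : c + c = (a - b) *: (P * (1 - g)).
  rewrite -{2}gc cE mulrDr -!scalerAr gP mulrA gP mulNr -mulrA (E_gg E_H) mulr1.
  rewrite mulrBr mulr1 scalerBr !scalerBl !scalerN opprB -!addrA.
  by congr (_ + _); rewrite [RHS]addrC -addrA.
rewrite mulrC -scalerA -c2 -mulr2n -scaler_nat scalerA mulVf // scale1r //.
Qed.

End Integrals.

(** * Coordinates of a tensor along a basis of its left factor *)

Section Coordinates.

Variables (K : fieldType) (U V : vectType K).

Definition tcoord (i : 'I_(dim U)) (t : tens U V) : V :=
  \sw_(u, v <- t) (v2r u 0 i *: v).

Lemma v2r_entry_linear (i : 'I_(dim U)) : linear (fun u : U => v2r u 0 i : K^o).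
Proof. by move=> k u u'; rewrite linearP !mxE. Qed.

Lemma tcoord_linear i : linear (tcoord i).
Proof. by rewrite /tcoord; lin. Qed.

Lemma tcoord_tpure i (u : U) (v : V) : tcoord i (u ⊗ v) = v2r u 0 i *: v.
Proof. by rewrite /tcoord tlift_tpure //; lin; apply: v2r_entry_linear. Qed.

Lemma tens_tcoord (t : tens U V) : t = \sum_i (tbasis i ⊗ tcoord i t).
Proof.
move: t; apply: tens_linear_eq => [|k t t'|u v].
- exact: lin_id.
- rewrite scaler_sumr -big_split; apply: eq_bigr => i _ /=.
  by rewrite tcoord_linear (tpure_linearr (tbasis i)).
have linv : linear (fun u : U => u ⊗ v) by lin.
pose L : {linear U -> tens U V} :=
  HB.pack (fun u : U => u ⊗ v) (GRing.isLinear.Build K U _ *:%R _ linv).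
rewrite {1}(vect_tbasis u) -[LHS]/(L _) linear_sum; apply: eq_bigr => i _.
by rewrite linearZ tcoord_tpure tpureZr.
Qed.

Lemma tpure_eq0 (u : U) (v : V) : v != 0 -> u ⊗ v = 0 -> u = 0.
Proof.
move=> v0 uv; rewrite (vect_tbasis u) big1 // => i _.
have := tcoord_tpure i u v; rewrite uv.
have -> : tcoord i 0 = 0.
  by have := tcoord_linear i (-1) 0 0; rewrite scaler0 addr0 scaleN1r addNr.
by move/esym/eqP; rewrite scaler_eq0 (negPf v0) orbF => /eqP->; rewrite scale0r.
Qed.

Lemma tcoordZ i k (t : tens U V) : tcoord i (k *: t) = k *: tcoord i t.
Proof.
have t0 : tcoord i 0 = 0.
  by have := tcoord_linear i (-1) 0 0; rewrite scaler0 addr0 scaleN1r addNr.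
by have := tcoord_linear i k t 0; rewrite t0 !addr0.
Qed.

End Coordinates.

(** * The integral attached to a Frobenius structure *)

Section Frobenius.

Variables (K : fieldType) (H : falgType K) (hH : hopf_algebra H).
Variables (A : falgType K) (cA : comodule_algebra hH A).

Let Delta := comul hH.
Let eps := counit hH.
Let rho := coact cA.

(** [beta] h is B(h ⊗ 1) with the counit applied to its H-leg; the last condition serves to invert
    the A-part of c. *)
Lemma frobenius_integral : cowreath_frobenius cA ->
  exists (c : tens A H) (beta : {linear H -> A}),
  [/\ forall h, (1 ⊗ h) * c = eps h *: c,
      forall a, (a ⊗ 1) * c = c * rho a &
      \sw_(a, h <- c) (a * beta h) = 1].
Proof.
case=> B [t [_ t_bil t_unit _]].
pose Phi (s : tens (tens A H) H) : tens A H :=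
  \sw_(p, r <- s) \sw_(a, h <- p) (eps h *: (a ⊗ r)).
have linPhi : linear Phi by rewrite /Phi; lin.
have Phi_t : Phi t = \sw_(p, r <- t) \sw_(a, h <- p) (eps h *: (a ⊗ r)) by [].
have PhiE a h r : Phi (a ⊗ h ⊗ r) = eps h *: (a ⊗ r).
  by rewrite /Phi tlift_tpure; [rewrite tlift_tpure //; lin| lin..].
(* The image under [Phi] of the first Frobenius identity; h = 1 and a = 1 give the two conditions on
   c. *)
have key a h : eps h *: ((a ⊗ 1) * Phi t) = (1 ⊗ h) * Phi t * rho a.
  have := congr1 Phi (t_bil a h); rewrite !(linear_tlift _ _ linPhi).
  have linl : linear (fun s : tens A H => eps h *: ((a ⊗ 1) * s)) by lin.
  have linr : linear (fun s : tens A H => (1 ⊗ h) * s * rho a) by lin.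
  rewrite Phi_t (linear_tlift _ _ linl) (linear_tlift _ _ linr) => E.
  apply: etrans (etrans _ E) _; last symmetry; apply: eq_tlift => p r.
    rewrite (linear_tlift _ _ linl) (linear_tlift _ _ linPhi).
    apply: eq_tlift => a' h'; rewrite PhiE -scalerAr tensM mul1r scalerA.
    by rewrite /eps rmorphM mulrC.
  rewrite (linear_tlift _ _ linr) (linear_tlift _ _ linPhi).
  apply: eq_tlift => a' h'.
  rewrite -[in LHS](tlift_id (rho a)).
  rewrite (linear_tlift (L := fun s => (1 ⊗ h) * (eps h' *: (a' ⊗ r)) * s)); last by lin.
  rewrite (linear_tlift _ _ linPhi); apply: eq_tlift => a0 a1.
  (* [Phi] produces eps(h_1) h_2, so h is expanded by the counit axiom to match. *)
  rewrite -[in LHS](counit_left hH h).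
  rewrite (linear_tlift (L := fun w =>
    ((1 : A) ⊗ w) * (eps h' *: (a' ⊗ r)) * (a0 ⊗ a1))); last by lin.
  rewrite (linear_tlift _ _ linPhi); apply: eq_tlift => h1 h2.
  rewrite PhiE tpureZr -scalerAr -!scalerAl !tensM mul1r scalerA.
  by rewrite /eps rmorphM mulrC.
pose Psi (s : tens A H) : A := \sw_(a, h <- s) (eps h *: a).
have linPsi : linear Psi by rewrite /Psi; lin.
have PsiE a s h : Psi ((a ⊗ 1) * s * (1 ⊗ h)) = eps h *: (a * Psi s).
  have linl : linear (fun s => Psi ((a ⊗ 1) * s * (1 ⊗ h))).
    by move=> k x y; rewrite mulrDr mulrDl -scalerAr -scalerAl linPsi.
  have linr : linear (fun s => eps h *: (a * Psi s)) by lin.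
  move: s; apply: tens_linear_eq linl linr _ => a' h'.
  rewrite !tensM /Psi !tlift_tpure; [|by lin..].
  by rewrite mul1r mulr1 -scalerAr scalerA /eps rmorphM mulrC.
have linb : linear (fun h => Psi (B (h ⊗ 1))).
  by move=> k x y; rewrite (tpure_linearl 1) linearP linPsi.
pose beta : {linear H -> A} := HB.pack (fun h => Psi (B (h ⊗ 1)))
  (GRing.isLinear.Build K H A *:%R _ linb).
exists (Phi t), beta; split=> [h|a|].
- have := key 1 h; rewrite /rho rmorph1 mulr1 => <-.
  by rewrite -tens1E mul1r.
- by have := key a 1; rewrite /eps rmorph1 scale1r -tens1E mul1r.
(* The unit identity at h = 1, with the counit applied to the H-leg. *)
have := congr1 Psi (t_unit 1); rewrite rmorph1 scale1r.
have -> : Psi (1 ⊗ 1) = 1.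
  by rewrite /Psi tlift_tpure; [rewrite /eps rmorph1 scale1r | lin..].
move=> <-; pose L (s : tens A H) := \sw_(a, h <- s) (a * beta h).
have linL : linear L by rewrite /L; lin.
rewrite -[LHS]/(L _) /Phi (linear_tlift _ _ linL) (linear_tlift _ _ linPsi).
apply: eq_tlift => p r; rewrite (linear_tlift _ _ linL) (linear_tlift _ _ linPsi).
apply: eq_tlift => a h; rewrite PsiE.
pose L' : {linear tens A H -> A} :=
  HB.pack L (GRing.isLinear.Build K _ A *:%R L linL).
by rewrite -[LHS]/(L' _) linearZ /= /L tlift_tpure //; lin.
Qed.

End Frobenius.

(** * A Frobenius structure forces semisimplicity when n is odd *)

Section CliffordFrobenius.

Variables (K : fieldType) (n : nat) (alpha : K) (beta gamma : 'I_n -> K).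
Variables (lambda : 'I_n -> 'I_n -> K).
Variables (H : falgType K) (hH : hopf_algebra H) (g : H) (x : 'I_n -> H).
Hypothesis E_H : is_E hH g x.
Variables (A : falgType K) (G : A) (X : 'I_n -> A).
Hypothesis presA :
  presented_by (@clifford_rels K n alpha beta gamma lambda) G X.
Variable cA : comodule_algebra hH A.
Hypothesis rho_A : canonical_coaction g x cA G X.
Hypotheses (odd_n : odd n) (two_neq0 : 2%:R != 0 :> K).

Lemma frobenius_semisimple : cowreath_frobenius cA -> semisimple A.
Proof.
case/frobenius_integral => c [b [c_int c_rho c_unit]].
have [lam [lam_g lam_x lam_int]] := E_left_integral E_H odd_n two_neq0.
have coordM i (h : H) (t : tens A H) : tcoord i ((1 ⊗ h) * t) = h * tcoord i t.
  have lr : linear (fun t : tens A H => h * tcoord i t).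
    by move=> k s s'; rewrite tcoord_linear mulrDr -scalerAr.
  have ll : linear (fun t : tens A H => tcoord i ((1 ⊗ h) * t)).
    by move=> k s s'; rewrite mulrDr -scalerAr tcoord_linear.
  move: t; apply: tens_linear_eq ll lr _ => a h'.
  by rewrite tensM !tcoord_tpure mul1r scalerAr.
(* Each coordinate of c is a left integral of E(n). *)
have ck i : {k | tcoord i c = k *: lam}.
  apply: sig_eqW; apply: lam_int => [|j]; rewrite -coordM c_int tcoordZ.
    by rewrite (E_counit_g E_H) scale1r.
  by rewrite (E_counit_x E_H) scale0r.
have [k kE] : {k | forall i, tcoord i c = k i *: lam}.
  by exists (fun i => sval (ck i)) => i; exact: (svalP (ck i)).
pose u := \sum_i k i *: tbasis i.
have linlam : linear (fun a : A => a ⊗ lam) by lin.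
pose L : {linear A -> tens A H} :=
  HB.pack (fun a : A => a ⊗ lam) (GRing.isLinear.Build K A _ *:%R _ linlam).
have cE : c = u ⊗ lam.
  rewrite [LHS]tens_tcoord -[RHS]/(L u) linear_sum; apply: eq_bigr => i _.
  by rewrite linearZ /= kE tpureZr.
have ub : u * b lam = 1 by rewrite -c_unit cE tlift_tpure //; lin.
have lam0 : lam != 0.
  by apply/eqP => lam0; move/eqP: ub; rewrite lam0 linear0 mulr0 eq_sym oner_eq0.
(* The sign comes from lam g = - lam; lam is nonzero, so it can be cancelled. *)
have anti y : (y ⊗ 1) * (u ⊗ lam) = (u ⊗ lam) * (y ⊗ g) -> y * u = - (u * y).
  rewrite !tensM mul1r lam_g => yu; apply/eqP; rewrite -addr_eq0; apply/eqP.
  apply: (tpure_eq0 lam0); rewrite -[LHS]/(L _) linearD /= yu.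
  by rewrite -scaleN1r tpureZr scaleN1r addNr.
have [rhoG rhoX] := rho_A.
apply: (clifford_semisimple presA two_neq0 ub) => [|i]; apply: anti.
  by rewrite -rhoG -cE c_rho.
(* The term 1 ⊗ x_i of the coaction contributes u ⊗ lam x_i = 0. *)
rewrite -cE c_rho rhoX mulrDr [in X in _ + X]cE tensM lam_x mulr1.
by rewrite -[in u ⊗ 0](scale0r 0) tpureZr scale0r addr0.
Qed.

End CliffordFrobenius.

(** * The three properties of the cowreath *)

Theorem corollary6p4 (K : fieldType) (char_neq2 : 2%N \notin [pchar K])
    (n : nat) (alpha : K) (beta gamma : 'I_n -> K) (lambda : 'I_n -> 'I_n -> K)
    (H : falgType K) (hH : hopf_algebra H) (g : H) (x : 'I_n -> H)
    (E_H : is_E hH g x)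
    (A : falgType K) (G : A) (X : 'I_n -> A)
    (Cl_A : is_clifford alpha beta gamma lambda G X)
    (cA : comodule_algebra hH A) (rho_A : canonical_coaction g x cA G X)
    (odd_n : odd n) (not_ss : ~ semisimple A) :
  [/\ cowreath_separable cA, cowreath_hseparable cA & ~ cowreath_frobenius cA].
Proof.
have [T [T1 TM Tg Tx]] := E_inverse_antipode_exists E_H.
have T_left := invantipode_left E_H T1 TM Tg Tx.
have T_right := invantipode_right E_H T1 TM Tg Tx.
have T_comul := comul_invantipode E_H T1 TM Tg Tx.
have cas := invantipode_is_casimir TM T_left T_right T_comul cA.
have norm := invantipode_normalized T_right A.
split; first by exists (invantipode_casimir T A).
  exists (invantipode_casimir T A); split=> // h h' h''.
  exact: invantipode_multiplicative.
have two_neq0 : 2%:R != 0 :> K by move: char_neq2; rewrite inE.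
case: Cl_A => presA _ frob; apply: not_ss.
exact: (frobenius_semisimple E_H presA rho_A odd_n two_neq0 frob).
Qed.
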